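(* Let $K$ be a field of characteristic zero. Every indecomposable, generalized weight $\mathbb{I}_1$-module is a uniserial module.
   Context: Modules are left modules. $K[x]$ is the polynomial algebra in one variable, $\partial=\frac{d}{dx}$, and $\int:K[x]\to K[x]$ is the $K$-linear map $x^s\mapsto \frac{x^{s+1}}{s+1}$ ($s\geq 0$). $\mathbb{I}_1=K\langle x,\partial,\int\rangle$ is the subalgebra of $\mathrm{End}_K(K[x])$ generated by (multiplication by) $x$, $\partial$ and $\int$. Put $H=\partial x\in\mathbb{I}_1$ (so $H$ sends $x^s$ to $(s+1)x^s$). An $\mathbb{I}_1$-module $M$ is a generalized weight module if $M=\bigoplus_{\lambda\in K}M^\lambda$, where $M^\lambda=\{m\in M \mid (H-\lambda)^k m=0 \text{ for some } k=k(m)\geq 1\}$. A module is uniserial if its submodules are totally ordered by inclusion. Indecomposable modules are nonzero. *)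

(* Defs.v *)
From HB Require Import structures.
From mathcomp Require Import all_boot all_order all_algebra.
From mathcomp Require Import boolp classical_sets functions cardinality fsbigop.

Set Implicit Arguments.
Unset Strict Implicit.
Unset Printing Implicit Defensive.

Import GRing.Theory.

Local Open Scope classical_set_scope.
Local Open Scope ring_scope.

(** The K-algebra End_K(K[x]), with composition as product. *)

Definition polyEnd (K : fieldType) : Type := {linear {poly K} -> {poly K}}.

Section PolyEnd.
Variable K : fieldType.
Local Notation E := (polyEnd K).

HB.instance Definition _ := gen_eqMixin E.
HB.instance Definition _ := gen_choiceMixin E.

Definition pe_zero : E := (\0 : {poly K} -> {poly K}).
Definition pe_one : E := @idfun {poly K}.
Definition pe_opp (f : E) : E := \- f.
Definition pe_add (f g : E) : E := f \+ g.
Definition pe_scale (a : K) (f : E) : E := a \*: f.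
Definition pe_mul (f g : E) : E := f \o g.

Lemma polyEndP (f g : E) : (forall p, f p = g p) -> f = g.
Proof.
case: f g => [f [[f1] [f2]]] [g [[g1] [g2]]] /= /funext fg; subst g.
by rewrite (Prop_irrelevance f1 g1) (Prop_irrelevance f2 g2).
Qed.

Fact pe_addA : associative pe_add.
Proof. by move=> f g h; apply: polyEndP => p /=; rewrite addrA. Qed.
Fact pe_addC : commutative pe_add.
Proof. by move=> f g; apply: polyEndP => p /=; rewrite addrC. Qed.
Fact pe_add0 : left_id pe_zero pe_add.
Proof. by move=> f; apply: polyEndP => p /=; rewrite add0r. Qed.
Fact pe_addN : left_inverse pe_zero pe_opp pe_add.
Proof. by move=> f; apply: polyEndP => p /=; rewrite addNr. Qed.

HB.instance Definition _ :=
  GRing.isZmodule.Build E pe_addA pe_addC pe_add0 pe_addN.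

Fact pe_mulA : associative pe_mul.
Proof. by move=> f g h; apply: polyEndP. Qed.
Fact pe_mul1l : left_id pe_one pe_mul.
Proof. by move=> f; apply: polyEndP. Qed.
Fact pe_mul1r : right_id pe_one pe_mul.
Proof. by move=> f; apply: polyEndP. Qed.
Fact pe_mulDl : left_distributive pe_mul pe_add.
Proof. by move=> f g h; apply: polyEndP. Qed.
Fact pe_mulDr : right_distributive pe_mul pe_add.
Proof. by move=> f g h; apply: polyEndP => p /=; rewrite linearD. Qed.
Fact pe_one_neq0 : pe_one != pe_zero.
Proof.
by apply/eqP => /(congr1 (fun f : E => f 1)) /= /eqP; rewrite oner_eq0.
Qed.

HB.instance Definition _ := GRing.Zmodule_isNzRing.Build E
  pe_mulA pe_mul1l pe_mul1r pe_mulDl pe_mulDr pe_one_neq0.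

Fact pe_scaleA a b (f : E) : pe_scale a (pe_scale b f) = pe_scale (a * b) f.
Proof. by apply: polyEndP => p /=; rewrite scalerA. Qed.
Fact pe_scale1 : left_id 1 pe_scale.
Proof. by move=> f; apply: polyEndP => p /=; rewrite scale1r. Qed.
Fact pe_scaleDr : right_distributive pe_scale +%R.
Proof. by move=> a f g; apply: polyEndP => p /=; rewrite scalerDr. Qed.
Fact pe_scaleDl (f : E) : {morph pe_scale^~ f : a b / a + b}.
Proof. by move=> a b; apply: polyEndP => p /=; rewrite scalerDl. Qed.

HB.instance Definition _ := GRing.Zmodule_isLmodule.Build K E
  pe_scaleA pe_scale1 pe_scaleDr pe_scaleDl.

Fact pe_scaleAl (a : K) (f g : E) : a *: (f * g) = (a *: f) * g.
Proof. exact: polyEndP. Qed.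

HB.instance Definition _ := GRing.Lmodule_isLalgebra.Build K E pe_scaleAl.

Fact pe_scaleAr (a : K) (f g : E) : a *: (f * g) = f * (a *: g).
Proof. by apply: polyEndP => p; rewrite [RHS]linearZ. Qed.

HB.instance Definition _ := GRing.Lalgebra_isAlgebra.Build K E pe_scaleAr.

End PolyEnd.

(** Subalgebra generated by a set: the intersection of all subalgebras
    containing it. *)

Definition subalg_gen (K : fieldType) (A : algType K) (G : set A) : {pred A} :=
  fun a => `[< forall S : {pred A},
    subalg_closed S -> (forall g, G g -> g \in S) -> a \in S >].

Section SubalgGen.
Variables (K : fieldType) (A : algType K) (G : set A).

Lemma subalg_gen_closed : subalg_closed (subalg_gen G).
Proof.
split=> [|a u v /asboolP Gu /asboolP Gv|u v /asboolP Gu /asboolP Gv];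
  apply/asboolP => S Sc SG; case: (Sc) => S1 Slin SM //.
- by apply: Slin; [exact: Gu | exact: Gv].
- by apply: SM; [exact: Gu | exact: Gv].
Qed.

HB.instance Definition _ := GRing.isSubalgClosed.Build K A (subalg_gen G)
  (GRing.subalg_closed_semi subalg_gen_closed).

Lemma mem_subalg_gen g : G g -> g \in subalg_gen G.
Proof. by move=> Gg; apply/asboolP => S _; apply. Qed.

End SubalgGen.

(** The three generating endomorphisms of K[x]. *)

Section Generators.
Variable K : fieldType.
Implicit Types p : {poly K}.

Definition mulX p : {poly K} := 'X * p.

Fact mulX_is_linear : linear mulX.
Proof. by move=> a p q; rewrite /mulX mulrDr scalerAr. Qed.
HB.instance Definition _ :=
  GRing.isLinear.Build K {poly K} {poly K} _ mulX mulX_is_linear.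

Definition integ p : {poly K} :=
  \sum_(s < size p) (p`_s / s.+1%:R) *: 'X^(s.+1).

Lemma integ_widen p n : (size p <= n)%N ->
  integ p = \sum_(s < n) (p`_s / s.+1%:R) *: 'X^(s.+1).
Proof.
move=> le_pn; pose F s : {poly K} := (p`_s / s.+1%:R) *: 'X^(s.+1).
rewrite /integ (big_ord_widen _ F le_pn) big_mkcond /=.
apply: eq_bigr => s _; case: ltnP => // le_ps.
by rewrite nth_default // mul0r scale0r.
Qed.

Fact integ_is_linear : linear integ.
Proof.
move=> a p q; pose n := maxn (size (a *: p + q)) (maxn (size p) (size q)).
rewrite !(@integ_widen _ n) ?leq_max ?leqnn ?orbT // scaler_sumr -big_split /=.
by apply: eq_bigr => s _; rewrite coefD coefZ mulrDl scalerDl scalerA mulrA.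
Qed.
HB.instance Definition _ :=
  GRing.isLinear.Build K {poly K} {poly K} _ integ integ_is_linear.

Lemma integXn s : integ 'X^s = (s.+1%:R)^-1 *: 'X^(s.+1).
Proof.
rewrite /integ size_polyXn big_ord_recr /= big1 => [|i _].
  by rewrite add0r coefXn eqxx mul1r.
by rewrite coefXn (ltn_eqF (ltn_ord i)) mul0r scale0r.
Qed.

Definition pe_x : polyEnd K := mulX.
Definition pe_d : polyEnd K := @deriv K.
Definition pe_int : polyEnd K := integ.

End Generators.

(** The algebra of polynomial integro-differential operators. *)

Record I1 (K : fieldType) := MkI1 {
  I1_val : polyEnd K;
  I1_valP : I1_val \in subalg_gen [set pe_x K; pe_d K; pe_int K]
}.

Section I1Algebra.
Variable K : fieldType.

HB.instance Definition _ := [isSub for @I1_val K].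
HB.instance Definition _ := [Choice of I1 K by <:].
HB.instance Definition _ := [SubChoice_isSubAlgebra of I1 K by <:].

Definition I1_x : I1 K :=
  MkI1 (@mem_subalg_gen K _ [set pe_x K; pe_d K; pe_int K] _
    (or_introl (or_introl erefl))).
Definition I1_d : I1 K :=
  MkI1 (@mem_subalg_gen K _ [set pe_x K; pe_d K; pe_int K] _
    (or_introl (or_intror erefl))).
Definition I1_int : I1 K :=
  MkI1 (@mem_subalg_gen K _ [set pe_x K; pe_d K; pe_int K] _
    (or_intror erefl)).

Definition I1_H : I1 K := I1_d * I1_x.

Lemma I1_HXn s : I1_val I1_H 'X^s = s.+1%:R *: 'X^s.
Proof. by rewrite /= /mulX -exprS derivXn scaler_nat. Qed.

End I1Algebra.

Section Modules.
Variables (R : pzRingType) (M : lmodType R).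

Definition is_submodule (N : set M) : Prop := submod_closed [pred m | m \in N].

Definition uniserial : Prop := forall N1 N2 : set M,
  is_submodule N1 -> is_submodule N2 -> N1 `<=` N2 \/ N2 `<=` N1.

Definition indecomposable : Prop :=
  (exists m : M, m != 0) /\
  forall N1 N2 : set M, is_submodule N1 -> is_submodule N2 ->
    N1 `&` N2 = [set 0] -> [set u + v | u in N1 & v in N2] = [set: M] ->
    N1 = [set 0] \/ N2 = [set 0].

(* [\sum_(i \in A) f i] is 0 when [f] has infinite support, hence the explicit
   finiteness condition. *)
Definition internal_direct_sum (I : choiceType) (V : I -> set M) : Prop :=
  forall m : M, exists! f : I -> M,
    [/\ forall i, V i (f i), finite_set [set i | f i != 0]
      & m = \sum_(i \in [set: I]) f i].

End Modules.

Section GeneralizedWeight.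
Variables (K : fieldType) (M : lmodType (I1 K)).

Definition gweight_space (lambda : K) : set M :=
  [set m | exists2 k : nat, (0 < k)%N &
    (I1_H K - lambda%:A) ^+ k *: m = 0].

Definition generalized_weight : Prop := internal_direct_sum gweight_space.

End GeneralizedWeight.
Arguments indecomposable {R} M.
Arguments uniserial {R} M.
Arguments generalized_weight {K} M.

(* Main.v *)
Require Import Defs.
From HB Require Import structures.
From mathcomp Require Import all_boot all_order all_algebra.
From mathcomp Require Import boolp classical_sets fsbigop.

(** The algebra [I1 K] is graded by the shifts of the weights that its elements
induce: [d] lowers weights by 1, [int] raises them by 1, and [d * int = 1],
while [e := 1 - int * d] is the projection of K[x] onto the constants.  In a
module [M], the part [e M] lies in weight 1 and is killed by [d].  For a
generalized weight module this forces a splitting of [M] into the part on which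
[d] is locally nilpotent and the part on which every [e * d ^ n] vanishes
([dtorsion_or_bijective]): in characteristic zero a vector has only finitely
many nonzero coefficients [e * d ^ n *: m], because [1 + n] meets the finitely
many weights of the vector only finitely often.  An indecomposable module is
therefore of one of two kinds.

If [d] is locally nilpotent on [M], then [M] is the module of polynomials with
coefficients in the vector space [ker d], the n-th coefficient being read off by
[e * d ^ n].  A decomposition of [ker d] decomposes [M], so [ker d] is a line,
[M] is isomorphic to K[x], and it is even simple ([dtorsion_uniserial]).

If [e] acts as zero, then [d] and [int] act as mutually inverse bijections.
Indecomposability confines the weights to one coset [a + Z]
([indecomposable_coset]), and then [M] is determined by the space [V] of vectors
of generalized weight [a] with its locally nilpotent endomorphism
[t := H - a]: submodules of [M] correspond to t-stable subspaces of [V]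
([sub_of_fiber], [submodule_induced]).  So [V] is an indecomposable torsion
module over the discrete valuation ring K[[t]].

The classification of such modules is the linear algebra that both cases use:
a nonzero locally nilpotent [t] always splits off a cyclic or a Pruefer summand,
whose socle is a line ([exists_rank1_summand]).  An indecomposable [V] is equal
to this summand, and the t-stable subspaces of a space whose socle is a line
form a chain ([rank1_uniserial]).  As [V] may have infinite dimension,
the complement of the summand comes from Zorn's lemma, by way of one linear
functional ([exists_functional]). *)

Set Implicit Arguments.
Unset Strict Implicit.
Unset Printing Implicit Defensive.

Import GRing.Theory.

Local Open Scope classical_set_scope.
Local Open Scope ring_scope.

(** * Submodules and decompositions *)

Section Submodules.
Variables (R : pzRingType) (M : lmodType R).
Implicit Types (N : set M) (u v m : M).

Lemma submoduleP N : is_submodule N <->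
  N 0 /\ forall a u v, N u -> N v -> N (a *: u + v).
Proof.
split=> -[N0 Nlin]; split.
- by have := N0; rewrite !inE.
- by move=> a u v Nu Nv; have := Nlin a u v; rewrite !inE; apply.
- by rewrite !inE.
- by move=> a u v; rewrite !inE; apply: Nlin.
Qed.

Lemma submodule0 N : is_submodule N -> N 0.
Proof. by case/submoduleP. Qed.

Lemma submoduleZD N a u v : is_submodule N -> N u -> N v -> N (a *: u + v).
Proof. by case/submoduleP => _; apply. Qed.

Lemma submoduleD N u v : is_submodule N -> N u -> N v -> N (u + v).
Proof. by move=> sN Nu Nv; rewrite -[u]scale1r; apply: submoduleZD. Qed.

Lemma submoduleZ N a u : is_submodule N -> N u -> N (a *: u).
Proof.
move=> sN Nu; rewrite -[_ *: _]addr0.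
by apply: submoduleZD => //; apply: submodule0.
Qed.

Lemma submoduleB N u v : is_submodule N -> N u -> N v -> N (u - v).
Proof.
by move=> sN Nu Nv; rewrite addrC -scaleN1r; apply: submoduleZD.
Qed.

Lemma submodule_zero : is_submodule [set 0 : M].
Proof.
by apply/submoduleP; split=> // a u v -> ->; rewrite /= scaler0 addr0.
Qed.

Lemma submodule_full : is_submodule [set: M].
Proof. by apply/submoduleP. Qed.

Lemma submoduleI N1 N2 :
  is_submodule N1 -> is_submodule N2 -> is_submodule (N1 `&` N2).
Proof.
move=> sN1 sN2; apply/submoduleP; split; first by split; apply: submodule0.
by move=> a u v [u1 u2] [v1 v2]; split; apply: submoduleZD.
Qed.

Definition sum_set N1 N2 : set M :=
  [set m | exists u v, [/\ N1 u, N2 v & m = u + v]].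

Lemma submodule_sum N1 N2 :
  is_submodule N1 -> is_submodule N2 -> is_submodule (sum_set N1 N2).
Proof.
move=> sN1 sN2; apply/submoduleP; split.
  by exists 0, 0; rewrite addr0; split=> //; apply: submodule0.
move=> a _ _ [u1 [v1 [Nu1 Nv1 ->]]] [u2 [v2 [Nu2 Nv2 ->]]].
exists (a *: u1 + u2), (a *: v1 + v2).
by rewrite scalerDr addrACA; split=> //; apply: submoduleZD.
Qed.

Lemma sum_setl N1 N2 m : is_submodule N2 -> N1 m -> sum_set N1 N2 m.
Proof.
by move=> sN2 N1m; exists m, 0; rewrite addr0; split=> //; apply: submodule0.
Qed.

Lemma sum_setr N1 N2 m : is_submodule N1 -> N2 m -> sum_set N1 N2 m.
Proof.
by move=> sN1 N2m; exists 0, m; rewrite add0r; split=> //; apply: submodule0.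
Qed.

Lemma indecomposable_split N1 N2 : indecomposable M ->
  is_submodule N1 -> is_submodule N2 -> N1 `&` N2 `<=` [set 0] ->
  (forall m, sum_set N1 N2 m) -> N1 `<=` [set 0] \/ N2 `<=` [set 0].
Proof.
move=> [_ indM] sN1 sN2 dis tot.
have [||-> | ->] := indM N1 N2 sN1 sN2; [| |by left|by right].
  apply/seteqP; split=> // m -> /=.
  by split; apply: submodule0.
apply/seteqP; split=> // m _; have [u [v [Nu Nv ->]]] := tot m.
by exists u => //; exists v.
Qed.

End Submodules.

(** * Linear functionals *)

Section LinearFunctional.
Variables (K : fieldType) (U : lmodType K).

(** A subspace containing [W] and maximal among those that avoid [s] is a
hyperplane complementary to the line of [s]; the functional is the coordinate
along that line. *)
Lemma exists_functional (W : set U) (s : U) : is_submodule W -> ~ W s ->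
  exists f : {scalar U}, f s = 1 /\ forall w, W w -> f w = 0.
Proof.
move=> sW Ws.
pose P (A : set U) := A = set0 \/ [/\ is_submodule A, W `<=` A & ~ A s].
have [|A [PA maxA]] := @Zorn_bigcup U P.
  move=> F FP Ftot.
  case: (pselect (exists2 A, F A & A !=set0)) => [[A0 FA0 [x0 A0x0]]|noF].
    right; have PF A x : F A -> A x -> [/\ is_submodule A, W `<=` A & ~ A s].
      by move=> /FP[-> //|].
    have [sA0 WA0 _] := PF _ _ FA0 A0x0.
    split; last 1 first.
    - by move=> [A FA As]; have [_ _] := PF _ _ FA As.
    - apply/submoduleP; split; first by exists A0 => //; apply: submodule0.
      move=> a u v [A FA Au] [B FB Bv].
      case: (Ftot A B FA FB) => [AB|BA].
        by exists B => //; have [sB _ _] := PF _ _ FB Bv; apply: submoduleZD;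
          auto.
      by exists A => //; have [sA _ _] := PF _ _ FA Au; apply: submoduleZD;
        auto.
    - by move=> w Ww; exists A0 => //; apply: WA0.
  left; apply/seteqP; split=> // x [A FA Ax]; apply: noF.
  by exists A => //; exists x.
have {PA}[sA WA As] : [/\ is_submodule A, W `<=` A & ~ A s].
  case: PA => // A0; case: (maxA W); last by right; split.
  by rewrite A0; split=> // W0; apply: (W0 0); apply: submodule0.
have line (u : U) : exists c : K, A (u - c *: s).
  case: (pselect (A u)) => [Au|Au]; first by exists 0; rewrite scale0r subr0.
  apply: contrapT => noc.
  pose B := [set v | exists b : K, A (v - b *: u)].
  have AB : A `<=` B by move=> v Av; exists 0; rewrite scale0r subr0.
  have Bu : B u by exists 1; rewrite scale1r subrr; apply: submodule0.
  apply: (maxA B); first by split=> // BA; apply: Au; apply: BA.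
  right; split=> [|w /WA/AB//|[b Asb]].
    apply/submoduleP; split; first by apply: AB; apply: submodule0.
    move=> a v1 v2 [b1 A1] [b2 A2]; exists (a * b1 + b2).
    have -> : a *: v1 + v2 - (a * b1 + b2) *: u =
              a *: (v1 - b1 *: u) + (v2 - b2 *: u).
      by rewrite scalerBr scalerDl scalerA opprD addrACA.
    exact: submoduleZD.
  have [b0|b0] := eqVneq b 0; first by apply: As;
    rewrite b0 scale0r subr0 in Asb.
  apply: noc; exists b^-1.
  have -> : u - b^-1 *: s = (- b^-1) *: (s - b *: u).
    by rewrite scalerBr scalerA mulNr mulVf // scaleN1r opprK addrC scaleNr.
  exact: submoduleZ.
have [f Af] := choice line.
have funiq u c : A (u - c *: s) -> f u = c.
  move=> Auc; apply: contrapT => /eqP; rewrite -subr_eq0 => fc0; apply: As.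
  rewrite -[s]scale1r -(mulVf fc0) -scalerA; apply: submoduleZ => //.
  have -> : (f u - c) *: s = (u - c *: s) - (u - f u *: s).
    by rewrite scalerBl opprB [RHS]addrC addrA subrK.
  exact: submoduleB.
have flin : scalar f.
  move=> a u v; apply: funiq.
  have -> : a *: u + v - (a * f u + f v) *: s =
            a *: (u - f u *: s) + (v - f v *: s).
    by rewrite scalerBr scalerDl scalerA opprD addrACA.
  exact: submoduleZD.
pose F : {scalar U} := HB.pack f (GRing.isLinear.Build K U K _ f flin).
exists F; split=> [|w /WA Aw].
  by apply: funiq; rewrite scale1r subrr; apply: submodule0.
by apply: funiq; rewrite scale0r subr0.
Qed.

End LinearFunctional.

(** * Locally nilpotent endomorphisms *)

Section TorsionModules.
Variables (K : fieldType) (U : lmodType K) (t : {linear U -> U}).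
Implicit Types (N V : set U) (u v : U).

Local Notation "t ^[ n ]" := (iter n t) (at level 2, format "t ^[ n ]").

Definition stable N := forall u, N u -> N (t u).

(** Nilpotence is local: the exponent depends on the vector. *)
Definition nilpotent_on N := forall u, N u -> exists n, t^[n] u = 0.

Lemma iter_linearP n a u v : t^[n] (a *: u + v) = a *: t^[n] u + t^[n] v.
Proof. by elim: n => //= n ->; rewrite linearP. Qed.

Lemma iter_linear0 n : t^[n] 0 = 0.
Proof. by elim: n => //= n ->; rewrite linear0. Qed.

Lemma iter_linearZ n a u : t^[n] (a *: u) = a *: t^[n] u.
Proof. by rewrite -[_ *: u]addr0 iter_linearP iter_linear0 addr0. Qed.

Lemma iter_linearB n u v : t^[n] (u - v) = t^[n] u - t^[n] v.
Proof. by rewrite addrC -scaleN1r iter_linearP scaleN1r addrC. Qed.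

Lemma iter_linear_sum n k (F : nat -> U) :
  t^[n] (\sum_(i < k) F i) = \sum_(i < k) t^[n] (F i).
Proof.
elim: k => [|k IH]; first by rewrite !big_ord0 iter_linear0.
by rewrite !big_ord_recr /= -[\sum_(i < k) F i]scale1r iter_linearP scale1r IH.
Qed.

Lemma iter_eq0 m n u : (m <= n)%N -> t^[m] u = 0 -> t^[n] u = 0.
Proof. by move=> /subnK <- um; rewrite iterD um iter_linear0. Qed.

Lemma stable_iter N n u : stable N -> N u -> N (t^[n] u).
Proof. by move=> tN Nu; elim: n => //= n; apply: tN. Qed.

Lemma nilpotent_order N u : nilpotent_on N -> N u -> u != 0 ->
  exists n, t^[n] u != 0 /\ t^[n.+1] u = 0.
Proof.
move=> nilN Nu u0; have [n] := nilN u Nu.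
elim: n => [/eqP|n IH un]; first by rewrite (negPf u0).
by have [/IH//|un0] := eqVneq (t^[n] u) 0; exists n.
Qed.

(** A chain [c 0, c 1, ...] climbs from a socle vector [c 0] by choosing
preimages under [t]; it either goes on for ever, spanning a Pruefer module, or
is zero from some [c n] on, spanning a cyclic module of length [n].  In the
second case [ftV] makes [f] vanish on the image of [t ^ n], which says that
[c 0] cannot be divided further.  The span [C] of the chain then has the
explicit complement [D], the largest t-stable subspace of [V] inside the kernel
of [f]: the values [f (t^[i] v)] are, up to a unitriangular change, the
coordinates along the chain of the [C]-component of [v]. *)
Section ChainSummand.
Variables (V : set U) (c : nat -> U) (f : {scalar U}).
Hypotheses (subV : is_submodule V) (stV : stable V) (nilV : nilpotent_on V).
Hypotheses (Vc : forall i, V (c i)) (fc0 : f (c 0%N) = 1) (tc0 : t (c 0%N) = 0).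
Hypotheses (tcS : forall i, t (c i.+1) = c i \/ c i.+1 = 0).
Hypotheses (c0S : forall i, c i = 0 -> c i.+1 = 0).
Hypotheses (ftV : forall i v, c i = 0 -> V v -> f (t^[i] v) = 0).

Let C : set U := [set v | exists n (k : nat -> K), v = \sum_(i < n) k i *: c i].
Let D : set U := [set v | V v /\ forall i, f (t^[i] v) = 0].

Let iter_chain i : c i = 0 \/ t^[i] (c i) = c 0%N.
Proof.
elim: i => [|i IH]; first by right.
have [ci|->] := tcS i; last by left.
by case: IH => [/c0S|ti]; [left | right; rewrite iterSr ci].
Qed.

Let iter_chain_gt i n : (i < n)%N -> t^[n] (c i) = 0.
Proof.
move=> lt_in; apply: (iter_eq0 lt_in).
by case: (iter_chain i) => [->|/= ->]; rewrite ?iter_linear0 ?linear0 ?tc0.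
Qed.

(* Applying [t^[n]] to a combination of [c 0, ..., c n] leaves only the top
coefficient, on [c 0]. *)
Let drop_top n (k : nat -> K) : f (t^[n] (\sum_(i < n.+1) k i *: c i)) = 0 ->
  \sum_(i < n.+1) k i *: c i = \sum_(i < n) k i *: c i.
Proof.
rewrite (iter_linear_sum _ _ (fun i => k i *: c i)) !big_ord_recr /=.
rewrite big1 => [|i _]; last by rewrite iter_linearZ iter_chain_gt ?scaler0.
rewrite add0r iter_linearZ; case: (iter_chain n) => [-> _|->].
  by rewrite scaler0 addr0.
by rewrite linearZ /= fc0 mulr1 => ->; rewrite scale0r addr0.
Qed.

Let Cc i : C (c i).
Proof.
exists i.+1, (fun j => (j == i)%:R); rewrite big_ord_recr /= eqxx scale1r.
rewrite big1 ?add0r // => j _; rewrite (_ : (_ == _) = false) ?scale0r //.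
exact/ltn_eqF/ltn_ord.
Qed.

Let subC : is_submodule C.
Proof.
apply/submoduleP; split; first by exists 0%N, (fun=> 0); rewrite big_ord0.
have wide n m (k : nat -> K) : (n <= m)%N -> \sum_(i < n) k i *: c i =
    \sum_(i < m) (if (i < n)%N then k i else 0) *: c i.
  move=> nm; rewrite (big_ord_widen _ (fun i => k i *: c i) nm) big_mkcond /=.
  by apply: eq_bigr => i _; case: ifP; rewrite // scale0r.
move=> a _ _ [n1 [k1 ->]] [n2 [k2 ->]].
rewrite (wide _ _ _ (leq_maxl n1 n2)) (wide _ _ _ (leq_maxr n1 n2)).
exists (maxn n1 n2), (fun i => a * (if (i < n1)%N then k1 i else 0) +
                               (if (i < n2)%N then k2 i else 0)).
rewrite scaler_sumr -big_split /=; apply: eq_bigr => i _.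
by rewrite scalerDl scalerA.
Qed.

Let stC : stable C.
Proof.
have tC i : C (t (c i)).
  case: i => [|i]; first by rewrite tc0; apply: submodule0.
  case: (tcS i) => ->; rewrite ?linear0; [exact: Cc | exact: submodule0].
move=> _ [n [k ->]]; rewrite linear_sum /=.
apply: (big_ind C) => [|u v|i _].
- exact: submodule0.
- exact: submoduleD.
- by rewrite linearZ; apply: submoduleZ.
Qed.

Let subD : is_submodule D.
Proof.
apply/submoduleP; split.
  by split=> [|i]; [exact: submodule0 | rewrite iter_linear0 linear0].
move=> a u v [Vu fu] [Vv fv]; split=> [|i]; first exact: submoduleZD.
by rewrite iter_linearP linearP /= fu fv mulr0 addr0.
Qed.

Let stD : stable D.
Proof. by move=> u [Vu fu]; split=> [|i]; [exact: stV | rewrite -iterSr]. Qed.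

Let CV v : C v -> V v.
Proof.
move=> [n [k ->]]; apply: (big_ind V) => [|x y|i _].
- exact: submodule0.
- exact: submoduleD.
- exact: submoduleZ.
Qed.

Let disjCD : C `&` D `<=` [set 0].
Proof.
move=> v [[n [k ->]]]; elim: n => [|n IH]; first by rewrite big_ord0.
by move=> Dv; have [_ fv] := Dv; have E := drop_top (fv n); rewrite E in Dv *;
  apply: IH.
Qed.

Let sumCD v : V v -> sum_set C D v.
Proof.
move=> Vv; have [n tn] := nilV Vv.
(* Subtracting a multiple of [c n] kills the last nonzero value of
   [i |-> f (t^[i] v)] without disturbing the vanishing of the later ones. *)
have: forall i, (n <= i)%N -> f (t^[i] v) = 0.
  by move=> i /iter_eq0 /(_ tn) ->; rewrite linear0.
elim: n v Vv {tn} => [|n IH] v Vv fv.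
  by apply: sum_setr => //; split=> // i; apply: fv.
rewrite -(subrK (f (t^[n] v) *: c n) v).
apply: submoduleD; [exact: submodule_sum | | apply: sum_setl => //]; last first.
  exact: submoduleZ.
apply: IH; first by apply: submoduleB => //; apply: submoduleZ.
move=> i; rewrite leq_eqVlt => /predU1P[<-|ni];
  rewrite iter_linearB iter_linearZ linearB linearZ /=.
  case: (iter_chain n) => [cn|->]; last by rewrite fc0 mulr1 subrr.
  by rewrite ftV // mul0r subrr.
by rewrite iter_chain_gt // linear0 mulr0 subr0 fv.
Qed.

Let kerC v : C v -> t v = 0 -> exists k, v = k *: c 0%N.
Proof.
move=> [n [k ->]]; elim: n => [|n IH].
  by rewrite big_ord0; exists 0; rewrite scale0r.
case: n IH => [_ _|n IH tv]; first by exists (k 0%N); rewrite big_ord1.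
have ftv: f (t^[n.+1] (\sum_(i < n.+2) k i *: c i)) = 0.
  by rewrite iterSr tv iter_linear0 linear0.
by rewrite (drop_top ftv) in tv *; apply: IH.
Qed.

Lemma chain_summand : exists C D : set U,
  [/\ is_submodule C, stable C, is_submodule D & stable D] /\
  [/\ C `<=` V, D `<=` V, C `&` D `<=` [set 0], V `<=` sum_set C D &
      C (c 0%N) /\ forall v, C v -> t v = 0 -> exists k, v = k *: c 0%N].
Proof. by exists C, D; split=> //; split=> // v []. Qed.

End ChainSummand.

(** If some socle vector [s] has a finite height [n], then a vector [y] with
[t^[n] y = s] generates a cyclic summand. Otherwise every socle vector is
infinitely divisible, which makes [t] surjective on [V] by induction on the
order of a vector, and a summand of Pruefer type is built upwards from any
socle vector. *)
Theorem exists_rank1_summand V : is_submodule V -> stable V ->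
  nilpotent_on V -> (exists2 v, V v & v != 0) ->
  exists s (C D : set U),
  [/\ is_submodule C, stable C, is_submodule D & stable D] /\
  [/\ C `<=` V, D `<=` V, C `&` D `<=` [set 0], V `<=` sum_set C D &
      [/\ s != 0, C s & forall v, C v -> t v = 0 -> exists k, v = k *: s]].
Proof.
move=> sV tV nV [v0 Vv0 v00].
suff [c [f [[Vc fc0 tc0] [tcS c0S ftV]]]] : exists (c : nat -> U) (f : {scalar
  U}),
    [/\ forall i, V (c i), f (c 0%N) = 1 & t (c 0%N) = 0] /\
    [/\ forall i, t (c i.+1) = c i \/ c i.+1 = 0,
        forall i, c i = 0 -> c i.+1 = 0 &
        forall i v, c i = 0 -> V v -> f (t^[i] v) = 0].
  have [C [D [? [? ? ? ? [? ?]]]]] := chain_summand sV tV nV Vc fc0 tc0 tcS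
    c0S ftV.
  exists (c 0%N), C, D; split=> //; split=> //; split=> //.
  by apply/eqP => c0; have := oner_neq0 K; rewrite -fc0 c0 linear0 eqxx.
pose height_ge n s := exists2 y, V y & t^[n] y = s.
case: (pselect (exists s n, [/\ V s, t s = 0, height_ge n s & ~ height_ge n.+1
  s])).
  move=> [s [n [Vs ts [y Vy yn] nhs]]].
  (* The chain is [s, ..., t y, y, 0, 0, ...]. *)
  have [||f [fs fW]] := @exists_functional _ U [set s | height_ge n.+1 s] s.
  - apply/submoduleP; split; first by exists 0; rewrite ?iter_linear0 //;
      apply: submodule0.
    move=> a _ _ [u Vu <-] [v Vv <-]; exists (a *: u + v);
      first exact: submoduleZD.
    exact: iter_linearP.
  - by [].
  have s0 : s <> 0 by move=> s0; apply: nhs; exists 0;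
    rewrite ?s0 ?iter_linear0 //; apply: submodule0.
  exists (fun i => if (i <= n)%N then t^[n - i] y else 0), f; split; split.
  - by move=> i; case: ifP => _; [exact: stable_iter | exact: submodule0].
  - by rewrite subn0 yn.
  - by rewrite subn0 yn.
  - move=> i; case: ifP => ni; last by right.
    by left; rewrite -iterS -subSn // (ltnW ni).
  - move=> i; case: (leqP i n) => [ni yi|ni _];
      last by rewrite ltnNge (ltnW ni).
    by case: s0; rewrite -yn; apply: (iter_eq0 _ yi); apply: leq_subr.
  - move=> i v; case: (leqP i n) => [ni yi|ni _] Vv.
      by case: s0; rewrite -yn; apply: (iter_eq0 _ yi); apply: leq_subr.
    apply: fW; exists (t^[i - n.+1] v); first exact: stable_iter.
    by rewrite -iterD subnKC.
move=> noheight.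
have soc_height s n : V s -> t s = 0 -> height_ge n s.
  move=> Vs ts; elim: n => [|n IH]; first by exists s.
  by apply: contrapT => ?; apply: noheight; exists s, n.
(* For [v] killed by [t^[n.+1]], the socle vector [t^[n] v] is divisible by
   [t^[n.+1]], so that [v] agrees with an element of the image of [t] up to a
   vector of smaller order. *)
have div v : V v -> exists2 w, V w & t w = v.
  move=> Vv; have [n] := nV v Vv; elim: n v Vv => [|n IH] v Vv tv.
    by exists 0; [exact: submodule0 | rewrite linear0 -tv].
  have [w Vw wn] := @soc_height (t^[n] v) n.+1 (stable_iter n tV Vv) tv.
  have [||w' Vw' tw'] := IH (v - t w).
  - by apply: submoduleB => //; apply: tV.
  - by rewrite iter_linearB -iterSr wn subrr.
  exists (w' + w); first exact: submoduleD.
  by rewrite linearD tw' subrK.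
have [n [sn0 sn]] := nilpotent_order nV Vv0 v00; pose s := t^[n] v0.
have /choice[g gV] v : exists w, V v -> V w /\ t w = v.
  case: (pselect (V v)) => [/div[w Vw tw]|Vv]; first by exists w.
  by exists v.
have [||f [fs _]] := @exists_functional _ U [set 0] s.
- exact: submodule_zero.
- exact/eqP.
have Vs i : V (iter i g s).
  by elim: i => [|i /gV[]//]; apply: stable_iter.
have ts i : t (iter i.+1 g s) = iter i g s by have /gV[] := Vs i.
have s0 i : iter i g s <> 0.
  elim: i => [|i IH si]; first exact/eqP.
  by apply: IH; rewrite -ts si linear0.
exists (fun i => iter i g s), f; split; split=> //.
- by move=> i; left; apply: ts.
- by move=> i /s0.
- by move=> i v /s0.
Qed.

(** When the socle of [V] is a line, a vector of smaller order is a combination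
of the [t^[i] v], for any [v] of larger order; so a t-stable subspace contains
all vectors whose order does not exceed that of one of its members. *)
Lemma rank1_uniserial V (s : U) : nilpotent_on V ->
  (forall v, V v -> t v = 0 -> exists k, v = k *: s) -> stable V ->
    is_submodule V ->
  forall X Y : set U, is_submodule X -> stable X -> X `<=` V ->
    is_submodule Y -> stable Y -> Y `<=` V -> X `<=` Y \/ Y `<=` X.
Proof.
move=> nV kerV tV sV.
have key (Z : set U) v n : is_submodule Z -> stable Z -> Z `<=` V ->
    Z v -> t^[n] v != 0 -> t^[n.+1] v = 0 ->
    forall m u, V u -> (m <= n.+1)%N -> t^[m] u = 0 -> Z u.
  move=> sZ tZ ZV Zv vn vnS; elim=> [|m IH] u Vu mn um.
    by rewrite (um : u = 0); apply: submodule0.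
  have [|k uk] := kerV (t^[m] u) _ um; first exact: stable_iter.
  have [|l vl] := kerV (t^[n] v) _ vnS; first by apply: stable_iter => //;
    apply: ZV.
  have l0 : l != 0 by apply: contraNneq vn => l0; rewrite vl l0 scale0r.
  pose w := (k / l) *: t^[n - m] v.
  have Zw : Z w by apply: submoduleZ => //; apply: stable_iter.
  rewrite -(subrK w u); apply: submoduleD => //; apply: IH.
  - by apply: submoduleB => //; apply: ZV.
  - exact: ltnW.
  - by rewrite iter_linearB iter_linearZ -iterD subnKC // uk vl scalerA divfK
      // subrr.
move=> X Y sX tX XV sY tY YV.
case: (pselect (X `<=` Y)) => [|XY]; first by left.
have [u Xu Yu] : exists2 u, X u & ~ Y u.
  apply: contrapT => nou; apply: XY => u Xu; apply: contrapT => Yu.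
  by apply: nou; exists u.
right=> v Yv.
have [->|v0] := eqVneq v 0; first exact: submodule0.
have [u0|u0] := eqVneq u 0; first by case: Yu; rewrite u0; apply: submodule0.
have [m [um umS]] := nilpotent_order nV (XV _ Xu) u0.
have [n [vn vnS]] := nilpotent_order nV (YV _ Yv) v0.
case: (leqP m n) => mn.
  by case: Yu; apply: (key Y v n sY tY YV Yv vn vnS m.+1) => //; apply: XV.
by apply: (key X u m sX tX XV Xu um umS n.+1) => //;
  [apply: YV | rewrite ltnS ltnW].
Qed.

End TorsionModules.

(** * Restriction of scalars *)

(** Modules over a K-algebra are also K-vector spaces; the alias carries this
second module structure on the same additive group, so that [is_submodule] can
speak both of submodules and of subspaces. *)
Definition restrict_scalars (K : fieldType) (A : algType K) (M : lmodType A) :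
  Type := M.

Section RestrictScalars.
Variables (K : fieldType) (A : algType K) (M : lmodType A).
Local Notation MK := (restrict_scalars M).

HB.instance Definition _ := GRing.Zmodule.copy MK M.

Definition restricted_scale (c : K) (m : MK) : MK := c%:A *: (m : M).

Fact restricted_scaleA a b (m : MK) :
  restricted_scale a (restricted_scale b m) = restricted_scale (a * b) m.
Proof. by rewrite /restricted_scale scalerA -in_algE -rmorphM. Qed.
Fact restricted_scale1 : left_id 1 restricted_scale.
Proof. by move=> m; rewrite /restricted_scale !scale1r. Qed.
Fact restricted_scaleDr : right_distributive restricted_scale +%R.
Proof. by move=> c u v; rewrite /restricted_scale scalerDr. Qed.
Fact restricted_scaleDl (m : MK) :
  {morph restricted_scale^~ m : a b / a + b}.
Proof. by move=> a b; rewrite /restricted_scale !scalerDl. Qed.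

HB.instance Definition _ := GRing.Zmodule_isLmodule.Build K MK
  restricted_scaleA restricted_scale1 restricted_scaleDr restricted_scaleDl.

Lemma restrict_scaleE (c : K) (m : MK) : c *: m = c%:A *: (m : M).
Proof. by []. Qed.

Definition act (a : A) (m : MK) : MK := a *: (m : M).

Fact act_linear a : linear (act a).
Proof.
move=> c u v; rewrite /act !restrict_scaleE scalerDr !scalerA.
by rewrite mulr_algl mulr_algr.
Qed.
HB.instance Definition _ a :=
  GRing.isLinear.Build K MK MK _ (act a) (act_linear a).

Lemma iter_act n a (m : MK) : iter n (act a) m = a ^+ n *: (m : M).
Proof. by elim: n => [|n IH] /=;
  rewrite ?expr0 ?scale1r // IH exprS -scalerA. Qed.

Definition subspace (N : set M) : Prop := @is_submodule K MK N.

Lemma submodule_subspace N : is_submodule N -> subspace N.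
Proof.
move=> sN; apply/submoduleP; split; first exact: (submodule0 sN).
by move=> c u v Nu Nv; apply: (submoduleZD c%:A sN).
Qed.

End RestrictScalars.

(** * Relations in the algebra *)

Section Relations.
Variable K : fieldType.
Local Notation H := (I1_H K).
Local Notation D := (I1_d K).
Local Notation J := (I1_int K).
Local Notation X := (I1_x K).

Lemma I1_eq (a b : I1 K) :
  (forall s, I1_val a 'X^s = I1_val b 'X^s) -> a = b.
Proof.
move=> ab; apply: val_inj; apply: polyEndP => p /=.
rewrite -[p]coefK poly_def !linear_sum; apply: eq_bigr => i _.
by rewrite !linearZ /= ab.
Qed.

(** Members of the generated subalgebra are known only through the subalgebras
that contain the generators; those members of it that satisfy [P] form one. *)
Lemma I1_gen_ind (P : I1 K -> Prop) :
  P 1 -> (forall c a b, P a -> P b -> P (c *: a + b)) ->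
  (forall a b, P a -> P b -> P (a * b)) -> P X -> P D -> P J ->
  forall a, P a.
Proof.
move=> P1 Plin PM PX PD PJ [a aP].
pose G := [set pe_x K; pe_d K; pe_int K].
pose S : {pred polyEnd K} := fun b => `[< exists b' : I1 K, I1_val b' = b /\ P
  b' >].
suff: a \in S by move=> /asboolP[b [ba Pb]];
  have <- : b = MkI1 aP by apply: val_inj.
have /asboolP aG := aP; apply: aG.
- split=> [|c u v|u v].
  + by apply/asboolP; exists 1.
  + by move=> /asboolP[u' [<- Pu]] /asboolP[v' [<- Pv]]; apply/asboolP;
      exists (c *: u' + v'); split; [|apply: Plin].
  + by move=> /asboolP[u' [<- Pu]] /asboolP[v' [<- Pv]]; apply/asboolP;
      exists (u' * v'); split; [|apply: PM].
- by move=> g [[->|->]|->]; apply/asboolP; [exists X | exists D | exists J].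
Qed.

Hypothesis charK0 : [pchar K] =i pred0.

Let natS_neq0 n : n.+1%:R != 0 :> K.
Proof. by rewrite ((pcharf0P K).1 charK0). Qed.

Lemma I1_xXn s : I1_val X 'X^s = 'X^(s.+1).
Proof. by rewrite /= /mulX -exprS. Qed.

Lemma I1_dXn s : I1_val D 'X^(s.+1) = s.+1%:R *: 'X^s.
Proof. by rewrite /= derivXn scaler_nat. Qed.

Lemma I1_intXn s : I1_val J 'X^s = s.+1%:R^-1 *: 'X^(s.+1).
Proof. exact: integXn. Qed.

Lemma I1_valM (a b : I1 K) p : I1_val (a * b) p = I1_val a (I1_val b p).
Proof. by []. Qed.

Lemma I1_valZ (a : I1 K) c p : I1_val a (c *: p) = c *: I1_val a p.
Proof. exact: linearZ. Qed.

Lemma I1_valD (a : I1 K) p q : I1_val a (p + q) = I1_val a p + I1_val a q.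
Proof. exact: linearD. Qed.

Lemma I1_val0 (a : I1 K) : I1_val a 0 = 0.
Proof. exact: linear0. Qed.

Lemma I1_d1 : I1_val D 'X^0 = 0.
Proof. exact: derivC. Qed.

Lemma I1_dJ : D * J = 1.
Proof.
apply: I1_eq => s; rewrite I1_valM I1_intXn I1_valZ I1_dXn scalerA mulVf //.
by rewrite scale1r.
Qed.

Lemma I1_JH : J * H = X.
Proof.
apply: I1_eq => s; rewrite I1_valM I1_HXn I1_valZ I1_intXn scalerA mulfV //.
by rewrite scale1r I1_xXn.
Qed.

Lemma I1_HJ : H * J = J * (H + 1).
Proof.
apply: I1_eq => s; rewrite (I1_valM H) (I1_valM J) I1_intXn I1_valZ I1_HXn.
rewrite [I1_val (H + 1) _](_ : _ = I1_val H 'X^s + 'X^s) //.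
rewrite I1_valD I1_HXn I1_valZ I1_intXn.
rewrite -[X in _ + X]scale1r !scalerA -scalerDl -[s.+2%:R]natr1.
by congr (_ *: _); rewrite mulrC mulrDl.
Qed.

Lemma I1_dH : D * H = (H + 1) * D.
Proof.
apply: I1_eq => s; rewrite (I1_valM D) (I1_valM _ D) I1_HXn I1_valZ.
rewrite [I1_val (H + 1) _](_ : _ = I1_val H (I1_val D 'X^s) + I1_val D 'X^s) //.
case: s => [|s]; first by rewrite I1_d1 I1_val0 addr0 scaler0.
rewrite I1_dXn I1_valZ I1_HXn !scalerA -scalerDl; congr (_ *: _).
by rewrite -[s.+2%:R]natr1 mulrC mulrDr mulr1.
Qed.

(** The projection of K[x] onto the constants. *)
Definition I1_e : I1 K := 1 - J * D.
Local Notation e := I1_e.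

Lemma I1_eXn s : I1_val e 'X^s = (s == 0%N)%:R *: 'X^s.
Proof.
rewrite [LHS](_ : _ = 'X^s - I1_val J (I1_val D 'X^s)) //; case: s => [|s].
  by rewrite I1_d1 I1_val0 subr0 scale1r.
by rewrite I1_dXn I1_valZ I1_intXn scalerA mulfV // scale1r subrr scale0r.
Qed.

Lemma I1_de : D * e = 0.
Proof. by rewrite mulrBr mulr1 mulrA I1_dJ mul1r subrr. Qed.

Lemma I1_eJ : e * J = 0.
Proof. by rewrite mulrBl mul1r -mulrA I1_dJ mulr1 subrr. Qed.

Lemma I1_eH : e * H = e.
Proof.
apply: I1_eq => s; rewrite (I1_valM e) I1_HXn I1_valZ I1_eXn.
by case: s => [|s]; rewrite ?scale1r // scale0r scaler0.
Qed.

End Relations.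

(** * Products of linear factors *)

Section RootProducts.
Variable K : fieldType.
Implicit Types s : seq K.

Definition root_prod s : {poly K} := \prod_(a <- s) ('X - a%:P).

Lemma root_prod_cat s1 s2 :
  root_prod (s1 ++ s2) = root_prod s1 * root_prod s2.
Proof. exact: big_cat. Qed.

Lemma root_prod_filter (Q : pred K) s :
  root_prod s = root_prod (filter Q s) * root_prod (filter (predC Q) s).
Proof. by rewrite /root_prod !big_filter (bigID Q). Qed.

(** This identity is what separates the weights of a module. *)
Lemma root_prod_bezout s1 s2 : (forall a, a \in s1 -> a \notin s2) ->
  exists u v, u * root_prod s1 + v * root_prod s2 = 1.
Proof.
move=> dis; suff /Bezout_eq1_coprimepP[[u v] uv] :
  coprimep (root_prod s1) (root_prod s2) by exists u, v.
elim: s1 dis => [|a s1 IH] dis; first by rewrite /root_prod big_nil coprime1p.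
rewrite /root_prod big_cons coprimepMl IH => [|b bs]; last first.
  by apply: dis; rewrite inE bs orbT.
by rewrite coprimep_sym coprimep_XsubC root_prod_XsubC dis ?mem_head.
Qed.

End RootProducts.

(** * Weights *)

Section Weights.
Variables (K : fieldType) (M : lmodType (I1 K)).
Hypothesis charK0 : [pchar K] =i pred0.
Implicit Types (m u v : M) (N : set M) (P Q : set K) (s : seq K).
Local Notation H := (I1_H K).
Local Notation D := (I1_d K).
Local Notation J := (I1_int K).
Local Notation e := (I1_e K).

(** As [x = int * H], the generator [x] can be traded for [H], which acts on
weight vectors almost as a scalar. *)
Lemma submodule_gen N : subspace N -> (forall m, N m -> N (D *: m)) ->
  (forall m, N m -> N (J *: m)) -> (forall m, N m -> N (H *: m)) ->
  is_submodule N.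
Proof.
move=> sN DN JN HN.
suff aN (a : I1 K) m : N m -> N (a *: m).
  apply/submoduleP; split; first exact: (submodule0 sN).
  by move=> a u v /aN au Nv; apply: (submoduleD sN).
elim/I1_gen_ind: a m => //.
- by move=> m; rewrite scale1r.
- move=> c a b aN bN m Nm; rewrite scalerDl -mulr_algl -scalerA.
  by apply: (submoduleZD c sN); auto.
- by move=> a b aN bN m Nm; rewrite -scalerA; auto.
- by move=> m Nm; rewrite -(I1_JH charK0) -scalerA; auto.
Qed.

Definition poly_H (p : {poly K}) : I1 K := horner_alg H p.

Lemma poly_HM p q : poly_H (p * q) = poly_H p * poly_H q.
Proof. exact: rmorphM. Qed.

Lemma poly_HD p q : poly_H (p + q) = poly_H p + poly_H q.
Proof. exact: rmorphD. Qed.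

Lemma poly_HXsubC a : poly_H ('X - a%:P) = H - a%:A.
Proof. by rewrite /poly_H rmorphB /= horner_algX horner_algC. Qed.

Lemma poly_HC p q m : poly_H p *: (poly_H q *: m) = poly_H q *: (poly_H p *: m).
Proof. by rewrite !scalerA -!poly_HM mulrC. Qed.

(** The sum of the generalized weight spaces with weight in [P], described by
annihilating polynomials rather than by decompositions.  The generalized weight
space of [a] is the case of [[set a]]. *)
Definition weights_in P : set M :=
  [set m | exists2 s, forall a, a \in s -> P a & poly_H (root_prod s) *: m = 0].

Lemma wtS P Q : P `<=` Q -> weights_in P `<=` weights_in Q.
Proof. by move=> PQ m [s sP sm]; exists s => // a /sP/PQ. Qed.

Lemma wt_subspace P : subspace (weights_in P).
Proof.
apply/submoduleP; split; first by exists [::]; rewrite // scaler0.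
move=> c u v [s1 s1P s1u] [s2 s2P s2v]; exists (s1 ++ s2).
  by move=> a; rewrite mem_cat => /orP[/s1P|/s2P].
have cH : c%:A = poly_H c%:P by rewrite /poly_H horner_algC.
rewrite root_prod_cat poly_HM -scalerA restrict_scaleE !scalerDr s2v scaler0.
by rewrite addr0 poly_HC cH (poly_HC _ c%:P) s1u !scaler0.
Qed.

Lemma wt_poly P p m : weights_in P m -> weights_in P (poly_H p *: m).
Proof. by move=> [s sP sm]; exists s; rewrite // poly_HC sm scaler0. Qed.

Lemma wt_H P m : weights_in P m -> weights_in P (H *: m).
Proof. by move=> /(wt_poly 'X); rewrite /poly_H horner_algX. Qed.

Lemma wt_disjoint P Q : P `&` Q = set0 -> weights_in P `&` weights_in Q `<=`
  [set 0].
Proof.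
move=> PQ0 m [[s1 s1P s1m] [s2 s2Q s2m]].
have [a /s1P Pa|u [v uv]] := @root_prod_bezout _ s1 s2.
  by apply/negP => /s2Q Qa; have : (P `&` Q) a by []; rewrite PQ0.
rewrite /= -[m]scale1r -[1](_ : poly_H 1 = 1); last exact: rmorph1.
by rewrite -uv poly_HD scalerDl !poly_HM -!scalerA s1m s2m !scaler0 addr0.
Qed.

(** The two components are polynomials in [H] applied to [m], hence belong to
every submodule that contains [m]. *)
Lemma poly_H_split (Q : pred K) s m : poly_H (root_prod s) *: m = 0 ->
  exists p q, [/\ m = poly_H p *: m + poly_H q *: m,
    poly_H (root_prod (filter Q s)) *: (poly_H p *: m) = 0 &
    poly_H (root_prod (filter (predC Q) s)) *: (poly_H q *: m) = 0].
Proof.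
move=> sm; have [a|u [v uv]] := @root_prod_bezout _ (filter Q s) (filter
  (predC Q) s).
  by rewrite !mem_filter /= => /andP[->].
exists (v * root_prod (filter (predC Q) s)), (u * root_prod (filter Q s));
  split.
- rewrite -scalerDl -poly_HD addrC uv (_ : poly_H 1 = 1) ?scale1r //.
  exact: rmorph1.
- rewrite scalerA -poly_HM mulrCA -root_prod_filter poly_HM -scalerA sm.
  by rewrite scaler0.
- rewrite scalerA -poly_HM mulrCA [_ * root_prod [seq _ <- _ | Q _]]mulrC.
  by rewrite -root_prod_filter poly_HM -scalerA sm scaler0.
Qed.

Lemma wt_split P m : weights_in setT m -> exists p q,
  [/\ m = poly_H p *: m + poly_H q *: m, weights_in P (poly_H p *: m) &
      weights_in (~` P) (poly_H q *: m)].
Proof.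
move=> [s _ sm]; have [p [q [pq ps qs]]] := poly_H_split (mem P) sm.
exists p, q; split=> //.
  by exists [seq a <- s | a \in P] => // a;
    rewrite mem_filter => /andP[/set_mem].
exists [seq a <- s | predC (mem P) a] => // a;
  rewrite mem_filter => /andP[/= aP _] Pa.
by move: aP; rewrite (mem_set Pa).
Qed.

(** The weight components of a vector belong to the submodule that it
generates, so a submodule is determined by its weight vectors. *)
Lemma sub_of_weights (wtM : forall m, weights_in setT m) N1 N2 :
  is_submodule N1 -> is_submodule N2 ->
  (forall a m, N1 m -> weights_in [set a] m -> N2 m) -> N1 `<=` N2.
Proof.
move=> sN1 sN2 N12 m N1m; have [s _ sm] := wtM m.
elim: {s}(size s) {-2}s (leqnn (size s)) m N1m sm => [|n IH] [|a s] //=.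
1,2: by move=> _ m _; rewrite /root_prod big_nil /poly_H rmorph1 scale1r => ->;
  exact: submodule0.
rewrite ltnS => sn m N1m sm.
have [p [q [mE ps qs]]] := poly_H_split (pred1 a) sm.
rewrite mE; apply: submoduleD => //.
  apply: (N12 a); first exact: submoduleZ.
  by exists (filter (pred1 a) (a :: s)) => // b;
    rewrite mem_filter => /andP[/eqP].
apply: IH qs; last exact: submoduleZ.
by rewrite /= eqxx /= size_filter (leq_trans (count_size _ _)).
Qed.

(** In the adjoint action of [H], the element [B] is an eigenvector of
eigenvalue [b]; it shifts weights by [b]. *)
Definition homog (b : K) (B : I1 K) := B * H = (H - b%:A) * B.

Lemma homogM b c B C : homog b B -> homog c C -> homog (b + c) (B * C).
Proof.
rewrite /homog => Bb Cc; rewrite -mulrA Cc !mulrA; congr (_ * _).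
by rewrite mulrBr Bb mulr_algr -[c *: B]mulr_algl -mulrBl scalerDl opprD addrA.
Qed.

Lemma homogX b B n : homog b B -> homog (b *+ n) (B ^+ n).
Proof.
move=> Bb; elim: n => [|n IH]; last by rewrite exprS mulrS; apply: homogM.
by rewrite /homog mulr0n scale0r subr0 mul1r mulr1.
Qed.

Lemma homog_d : homog (-1) D.
Proof. by rewrite /homog scaleN1r opprK; apply: I1_dH. Qed.

Lemma homog_J : homog 1 J.
Proof.
by rewrite /homog scale1r mulrBl I1_HJ mulrDr mulr1 mul1r addrK.
Qed.

Lemma homog_root_prod b B s : homog b B ->
  B * poly_H (root_prod s) = poly_H (root_prod [seq a + b | a <- s]) * B.
Proof.
move=> Bb; elim: s => [|a s IH].
  by rewrite /root_prod !big_nil /poly_H rmorph1 mul1r mulr1.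
rewrite /root_prod /= !big_cons !poly_HM !poly_HXsubC -!/(root_prod _) -mulrA
  -IH.
rewrite !mulrA; congr (_ * _); rewrite mulrBr Bb mulr_algr.
by rewrite -[a *: B]mulr_algl -mulrBl scalerDl opprD addrAC addrA.
Qed.

Lemma wt_homog P b B m : homog b B -> weights_in P m ->
  weights_in [set a | P (a - b)] (B *: m).
Proof.
move=> Bb [s sP sm]; exists [seq a + b | a <- s].
  by move=> _ /mapP[a /sP Pa ->]; rewrite /= addrK.
by rewrite scalerA -homog_root_prod // -scalerA sm scaler0.
Qed.

Lemma wt_act_nilpotent a :
  nilpotent_on (act (H - a%:A) : {linear restrict_scalars M -> _}) (weights_in
    [set a]).
Proof.
move=> m [s sa sm]; exists (size s); rewrite iter_act.
suff -> : (H - a%:A) ^+ size s = poly_H (root_prod s) by exact: sm.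
have /all_pred1P -> : all (pred1 a) s by apply/allP => b /sa /= ->.
rewrite size_nseq -poly_HXsubC.
by rewrite /root_prod big_nseq -Monoid.iteropE /poly_H -rmorphXn.
Qed.

Lemma generalized_weight_wt : generalized_weight M -> forall m, weights_in
  setT m.
Proof.
move=> gw m; have [f [[fw fin ->] _]] := gw m.
elim/big_ind: _ => [|u v|a _].
- exact: (submodule0 (wt_subspace _)).
- exact: (submoduleD (wt_subspace _)).
have [k _ km] := fw a; exists (nseq k a) => //.
rewrite -km /root_prod big_nseq -Monoid.iteropE /poly_H rmorphXn /=.
by rewrite rmorphB /= horner_algX horner_algC.
Qed.

End Weights.

(** * Coefficients along powers of the derivation *)

Section Decomposition.
Variables (K : fieldType) (M : lmodType (I1 K)).
Hypothesis charK0 : [pchar K] =i pred0.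
Implicit Types (m u v : M) (N C : set M) (P Q : set K) (s : seq K).
Local Notation H := (I1_H K).
Local Notation D := (I1_d K).
Local Notation J := (I1_int K).
Local Notation e := (I1_e K).

Lemma natr_inj : injective (fun n => n%:R : K).
Proof.
move=> m n /=; wlog le_mn : m n / (m <= n)%N => [wl mn|mn].
  by case/orP: (leq_total m n) => /wl; [apply | move/(_ (esym mn))].
apply/eqP; rewrite eqn_leq le_mn -subn_eq0 -((pcharf0P K).1 charK0) natrB //=.
by rewrite mn subrr.
Qed.

Lemma e_decomposition m : m = e *: m + J *: (D *: m).
Proof. by rewrite scalerBl scale1r scalerA subrK. Qed.

Lemma scale_dJ m : D *: (J *: m) = m.
Proof. by rewrite scalerA I1_dJ // scale1r. Qed.

Lemma homog_scale b B m : homog b B ->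
  B *: (H *: m) = H *: (B *: m) - b%:A *: (B *: m).
Proof. by move=> Bb; rewrite scalerA Bb -scalerA scalerBl. Qed.

(** From [e * H = e]: on the right of [e] a polynomial in [H] takes its value
at 1. *)
Lemma e_poly_H s :
  e * poly_H (root_prod s) = (\prod_(a <- s) (1 - a)) *: e.
Proof.
elim: s => [|a s IH].
  by rewrite /root_prod !big_nil /poly_H rmorph1 mulr1 scale1r.
rewrite /root_prod !big_cons -/(root_prod s) poly_HM poly_HXsubC mulrA mulrBr.
by rewrite I1_eH // mulr_algr -{1}[e]scale1r -scalerBl -scalerAl IH scalerA.
Qed.

Lemma e_scale0 P m : weights_in P m -> ~ P 1 -> e *: m = 0.
Proof.
move=> [s sP sm] P1.
have s1 : \prod_(a <- s) (1 - a) != 0.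
  rewrite prodf_seq_neq0; apply/allP => a /sP Pa /=; rewrite subr_eq0.
  by apply/eqP => a1; apply: P1; rewrite a1.
have := congr1 (fun x => e *: x) sm; rewrite scaler0 scalerA e_poly_H => E.
have -> : e = (\prod_(a <- s) (1 - a))^-1 *: ((\prod_(a <- s) (1 - a)) *: e).
  by rewrite scalerA mulVf // scale1r.
by rewrite -mulr_algl -scalerA E scaler0.
Qed.

(** The vector [d ^ n m] has the weights of [m] lowered by [n], and [e] kills
all weights but 1. In characteristic zero the numbers [1 + n] are distinct, so
only finitely many [n] have [1 + n] among the weights of [m]. *)
Lemma e_dX_eventually0 m : weights_in setT m ->
  exists n0, forall n, (n0 <= n)%N -> e *: (D ^+ n *: m) = 0.
Proof.
move=> [s _ sm].
have [n0 n0s] : exists n0, forall n, (n0 <= n)%N -> n.+1%:R \notin s.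
  elim: s {sm} => [|a s [n0 IH]]; first by exists 0%N.
  case: (pselect (exists k, a = k.+1%:R)) => [[k ->]|noa].
    exists (maxn k.+1 n0) => n; rewrite geq_max => /andP[kn /IH ns].
    rewrite inE negb_or ns andbT.
    by rewrite (inj_eq natr_inj) eqSS gtn_eqF.
  exists n0 => n /IH ns; rewrite inE negb_or ns andbT.
  by apply/eqP => an; apply: noa; exists n.
exists n0 => n /n0s ns.
have wm : weights_in [set` s] m by exists s.
have wn := wt_homog (homogX n (homog_d K)) wm.
apply: (e_scale0 wn).
by rewrite /= mulNrn opprK -mulrS (negPf ns).
Qed.

Definition dtorsion : set M := [set m | exists n, D ^+ n *: m = 0].

Lemma dX_linear n c (u v : restrict_scalars M) :
  D ^+ n *: ((c *: u + v : restrict_scalars M) : M) =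
  c%:A *: (D ^+ n *: (u : M)) + D ^+ n *: (v : M).
Proof. exact: (linearP (act (D ^+ n) : {linear restrict_scalars M -> _})). Qed.

Lemma e_linear c u v : e *: (c%:A *: u + v) = c%:A *: (e *: u) + e *: v.
Proof. exact: (linearP (act e : {linear restrict_scalars M -> _})). Qed.

Lemma submodule_dtorsion : is_submodule dtorsion.
Proof.
apply: submodule_gen => // [|m [n mn]|m [n mn]|m [n mn]].
- apply/submoduleP; split; first by exists 0%N; rewrite scaler0.
  move=> c u v [n1 un] [n2 vn]; exists (n1 + n2)%N.
  rewrite dX_linear exprD -[in X in _ + X]scalerA vn scaler0 addr0.
  by rewrite -exprD addnC exprD -scalerA un !scaler0.
- by exists n; rewrite scalerA -exprSr exprS -scalerA mn scaler0.
- by exists n.+1; rewrite exprSr -scalerA scale_dJ.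
- by exists n; rewrite (homog_scale _ (homogX n (homog_d K))) mn !scaler0 subr0.
Qed.

(** On K[x], the value of [e * d ^ n] at [m] is the Taylor coefficient of [m]
at 0, multiplied by the factorial of [n]. *)
Definition taylor_in C : set M := [set m | forall n, C (e *: (D ^+ n *: m))].

Lemma submodule_taylor_in C : subspace C -> is_submodule (taylor_in C).
Proof.
move=> sC; apply: submodule_gen => // [|m Cm n|m Cm n|m Cm n].
- apply/submoduleP; split; first by move=> n; rewrite !scaler0;
    apply: (submodule0 sC).
  by move=> c u v Cu Cv n; rewrite dX_linear e_linear;
    apply: (submoduleZD c sC).
- by rewrite [D ^+ n *: _]scalerA -exprSr.
- case: n => [|n].
    by rewrite expr0 scale1r scalerA I1_eJ // scale0r; apply: (submodule0 sC).
  by rewrite exprSr -[D ^+ n * D *: _]scalerA scale_dJ.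
- rewrite (homog_scale _ (homogX n (homog_d K))) scalerBr [e *: (H *:
    _)]scalerA I1_eH //.
  apply: (submoduleB sC) => //.
  set b := (_ *+ n); have := e_linear b (D ^+ n *: m) 0.
  by rewrite scaler0 !addr0 => ->; apply: (submoduleZ b sC).
Qed.

End Decomposition.

(** * Modules on which the derivation is locally nilpotent *)

Section Uniserial.
Variables (K : fieldType) (M : lmodType (I1 K)).
Hypothesis charK0 : [pchar K] =i pred0.
Implicit Types (m u v : M) (N C : set M) (P Q : set K).
Local Notation H := (I1_H K).
Local Notation D := (I1_d K).
Local Notation J := (I1_int K).
Local Notation e := (I1_e K).
Local Notation MK := (restrict_scalars M).

Lemma d_e_scale m : D *: (e *: m) = 0.
Proof. by rewrite scalerA I1_de // scale0r. Qed.

Lemma e_scale_id m : D *: m = 0 -> e *: m = m.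
Proof. by move=> Dm; rewrite {2}[m]e_decomposition Dm scaler0 addr0. Qed.

(** By induction on the nilpotency order, from [m = e m + int (d m)] with [e m]
in the kernel of [d]. *)
Lemma dtorsion_sub N : is_submodule N -> (forall m, D *: m = 0 -> N m) ->
  @dtorsion K M `<=` N.
Proof.
move=> sN kerN m [n]; elim: n m => [|n IH] m.
  by rewrite expr0 scale1r => ->; apply: submodule0.
rewrite exprSr -scalerA => /IH Nm; rewrite [m]e_decomposition.
by apply: submoduleD => //; [apply/kerN/d_e_scale | apply: submoduleZ].
Qed.

(** The last nonzero derivative of [m] lies in the kernel of [d], where [e] is
the identity. *)
Lemma dtorsion_taylor_eq0 : @dtorsion K M `&` taylor_in [set 0] `<=` [set 0].
Proof.
move=> m [[n mn] em] /=; elim: n mn => [|n IH mn];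
  first by rewrite expr0 scale1r.
have Dn : D *: (D ^+ n *: m) = 0 by rewrite scalerA -exprS.
by apply: IH; rewrite -(e_scale_id Dn); apply: em.
Qed.

(** The d-torsion vectors and the vectors without Taylor coefficients form
complementary submodules: a vector with finitely many nonzero coefficients is
the sum of its Taylor expansion and of a vector without coefficients. If the
torsion part is zero then so is [e], which takes its values there. *)
Lemma dtorsion_or_bijective : indecomposable M -> (forall m, weights_in setT
  m) ->
  (forall m, dtorsion m) \/ (forall m, J *: (D *: m) = m).
Proof.
move=> indM wtM.
have s0 : subspace [set 0 : M] := submodule_subspace (@submodule_zero _ M).
have sF := submodule_taylor_in charK0 s0.
have sT := @submodule_dtorsion _ M charK0.
have tot m : sum_set (@dtorsion K M) (taylor_in [set 0]) m.
  have [n] := e_dX_eventually0 charK0 (wtM m).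
  elim: n m => [|n IH] m em; first by apply: sum_setr => // n; apply: em.
  have sm : sum_set (@dtorsion K M) (taylor_in [set 0]) (D *: m).
    by apply: IH => k nk; rewrite [D ^+ k *: _]scalerA -exprSr; apply: em.
  rewrite [m]e_decomposition; apply: submoduleD; first exact: submodule_sum.
    by apply: sum_setl => //; exists 1%N; rewrite expr1 d_e_scale.
  by apply: submoduleZ => //; apply: submodule_sum.
have [T0|F0] := indecomposable_split indM sT sF dtorsion_taylor_eq0 tot.
  right=> m; rewrite {2}[m]e_decomposition (T0 (e *: m)) ?add0r //.
  by exists 1%N; rewrite expr1 d_e_scale.
by left=> m; have [u [v [Tu /F0 -> ->]]] := tot m; rewrite addr0.
Qed.

(** Taylor coefficients transport a decomposition of the vector space [ker d]
to [M], so [ker d] is a line. The kernel is split by the lemma on locally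
nilpotent endomorphisms, applied to zero. Every nonzero submodule meets [ker
d], hence contains it, hence is [M]. *)
Lemma dtorsion_uniserial : indecomposable M -> (forall m, dtorsion m) ->
  uniserial M.
Proof.
move=> indM torM.
have zeroE (u : MK) : act 0 u = 0 by rewrite /act scale0r.
pose V : set M := [set m | D *: m = 0].
have sV : subspace V.
  apply/submoduleP; split; first by rewrite /V /= scaler0.
  move=> c u v Du Dv; have := linearP (act D : {linear MK -> MK}) c u v.
  by rewrite /= /V /= {1 3}/act Dv addr0 => ->; rewrite /act Du scaler0.
have tV : stable (act 0 : {linear MK -> MK}) V.
  by move=> u _; rewrite /= zeroE; apply: (submodule0 sV).
have nV : nilpotent_on (act 0 : {linear MK -> MK}) V.
  by move=> u _; exists 1%N; apply: zeroE.
have Vneq0 N : is_submodule N -> (exists2 m, N m & m != 0) ->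
    exists m, [/\ N m, V m & m != 0].
  move=> sN [m Nm m0]; apply: contrapT => noV.
  have Nd0 : N `&` V `<=` [set 0].
    by move=> v [Nv Vv]; apply: contrapT => /eqP v0; apply: noV; exists v.
  have [n mn] := torM m; move/eqP: m0; apply.
  elim: n mn => [|n IH mn]; first by rewrite expr0 scale1r.
  apply: IH; apply: Nd0; split; first exact: submoduleZ.
  by rewrite /V /= scalerA -exprS.
have [m0 [_ Vm0 m00]] : exists m, [/\ [set: M] m, V m & m != 0].
  by apply: Vneq0; [exact: submodule_full | case: indM => -[m]; exists m].
have [s [C [C' [[sC _ sC' _] [CV CV' CC' VCC' [s0 Cs kerC]]]]]] :=
  exists_rank1_summand sV tV nV (ex_intro2 _ _ m0 Vm0 m00).
have liftV B : subspace B -> B `<=` V -> B `<=` taylor_in B.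
  move=> sB BV b Bb [|n]; first by rewrite expr0 scale1r e_scale_id //;
    apply: BV.
  by rewrite exprSr -scalerA (BV b Bb) !scaler0; apply: (submodule0 sB).
have sNC := submodule_taylor_in charK0 sC.
have sNC' := submodule_taylor_in charK0 sC'.
have dis : taylor_in C `&` taylor_in C' `<=` [set 0].
  move=> m [Cm C'm]; apply: dtorsion_taylor_eq0; split; first exact: torM.
  by move=> n; apply: CC'; split; [apply: Cm | apply: C'm].
have tot m : sum_set (taylor_in C) (taylor_in C') m.
  apply: (dtorsion_sub _ _ (torM m)); first exact: submodule_sum.
  move=> v /VCC'[c [c' [Cc C'c' ->]]]; exists c, c'.
  by split=> //; apply: liftV.
have [NC0|NC'0] := indecomposable_split indM sNC sNC' dis tot.
  by case/eqP: s0; apply: NC0; apply: liftV.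
have VK v : V v -> exists k, v = k%:A *: s.
  move=> /VCC'[c [c' [Cc /(liftV _ sC' CV')/NC'0 -> ->]]].
  have [|k ck] := kerC c Cc; first exact: zeroE.
  by exists k; rewrite addr0.
have simple N : is_submodule N -> (exists2 m, N m & m != 0) -> forall m, N m.
  move=> sN /(Vneq0 N sN)[v [Nv /VK[k vk] v0]] m.
  apply: (dtorsion_sub sN _ (torM m)) => w /VK[l ->]; apply: submoduleZ => //.
  have k0 : k != 0 by apply: contraNneq v0 => k0; rewrite vk k0 !scale0r.
  have -> : s = (k^-1)%:A *: v.
    by rewrite vk scalerA -in_algE -rmorphM mulVf // rmorph1 scale1r.
  exact: submoduleZ.
move=> N1 N2 sN1 sN2; case: (pselect (N1 `<=` [set 0])) => [N10|N10].
  by left=> m /N10 ->; apply: submodule0.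
right=> m _; apply: simple => //; apply: contrapT => noN1; apply: N10 => v N1v.
by apply: contrapT => /eqP v0; apply: noN1; exists v.
Qed.

End Uniserial.

(** * Modules on which the derivation is bijective *)

Section Bijective.
Variables (K : fieldType) (M : lmodType (I1 K)).
Hypothesis charK0 : [pchar K] =i pred0.
Hypothesis scale_Jd : forall m : M, I1_int K *: (I1_d K *: m) = m.
Hypothesis wtM : forall m : M, weights_in setT m.
Implicit Types (m u v : M) (N C V : set M) (P Q : set K) (a : K).
Local Notation H := (I1_H K).
Local Notation D := (I1_d K).
Local Notation J := (I1_int K).
Local Notation MK := (restrict_scalars M).

(** As [d] and [int] are inverse to each other on [M], this acts as the
integral power [i - j] of [d]; pairs of natural numbers avoid a case
distinction on the sign. *)
Definition shift i j : I1 K := D ^+ i * J ^+ j.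

Lemma shift_d i j m : shift i j *: (D *: m) = shift i.+1 j *: m.
Proof.
rewrite /shift exprSr -!mulrA -!scalerA; congr (_ *: _).
elim: j m => [|j IH] m; first by rewrite expr0 !scale1r.
by rewrite exprSr -!scalerA scale_Jd -[in RHS]IH scale_dJ.
Qed.

Lemma shift_J i j m : shift i j *: (J *: m) = shift i j.+1 *: m.
Proof. by rewrite scalerA /shift exprSr mulrA. Qed.

Lemma shiftii i m : shift i i *: m = m.
Proof.
elim: i m => [|i IH] m; first by rewrite /shift !expr0 mulr1 scale1r.
by rewrite -shift_d -shift_J IH scale_Jd.
Qed.

Lemma shiftK i j m : shift j i *: (shift i j *: m) = m.
Proof.
rewrite {2}/shift -scalerA.
have shJ k p q u : shift p q *: (J ^+ k *: u) = shift p (q + k) *: u.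
  elim: k u => [|k IH] u; first by rewrite expr0 scale1r addn0.
  by rewrite exprSr -scalerA IH shift_J addnS.
have shD k p q u : shift p q *: (D ^+ k *: u) = shift (p + k) q *: u.
  elim: k u => [|k IH] u; first by rewrite expr0 scale1r addn0.
  by rewrite exprSr -scalerA IH shift_d addnS.
by rewrite shD shJ addnC shiftii.
Qed.

Lemma homog_shift i j : homog (j%:R - i%:R) (shift i j).
Proof.
have := homogM (homogX i (homog_d K)) (homogX j (homog_J K)).
by rewrite mulNrn addrC.
Qed.

Lemma shift_linear i j c u v :
  shift i j *: (c%:A *: u + v) = c%:A *: (shift i j *: u) + shift i j *: v.
Proof. exact: (linearP (act (shift i j) : {linear MK -> MK})). Qed.

Definition coset a : set K := [set b | exists i j : nat, b = a + i%:R - j%:R].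

Lemma cosetD a b : coset a (b + 1) <-> coset a b.
Proof.
split=> [[i [j bij]]|[i [j bij]]].
  by exists i, j.+1; rewrite -[j.+1%:R]natr1 opprD addrA -bij addrK.
by exists i.+1, j; rewrite -[i.+1%:R]natr1 addrA bij [LHS]addrAC.
Qed.

(** The generators move weights by integers only. *)
Lemma wt_invariant_submodule P : (forall b, P (b + 1) <-> P b) ->
  is_submodule (weights_in P : set M).
Proof.
move=> PD; apply: submodule_gen => //; first exact: wt_subspace.
- move=> m /(wt_homog (homog_d K)); apply: wtS => b /=.
  by rewrite opprK => /PD.
- move=> m /(wt_homog (homog_J K)); apply: wtS => b /= /PD.
  by rewrite subrK.
- by move=> m; apply: wt_H.
Qed.

Lemma indecomposable_coset a : indecomposable M ->
  (exists2 m : M, weights_in [set a] m & m != 0) -> forall m, weights_in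
    (coset a) m.
Proof.
move=> indM [m0 wm0 m00].
have Ca : coset a a by exists 0%N, 0%N; rewrite addr0 subr0.
have sP := wt_invariant_submodule (cosetD a).
have sQ : is_submodule (weights_in (~` coset a) : set M).
  by apply: wt_invariant_submodule => b; split=> ncb /cosetD.
have dis : weights_in (coset a) `&` weights_in (~` coset a) `<=` [set 0 : M].
  by apply: wt_disjoint; rewrite setICr.
have tot m : sum_set (weights_in (coset a)) (weights_in (~` coset a)) m.
  have [p [q [mE pm qm]]] := wt_split (coset a) (wtM m).
  by exists (poly_H p *: m), (poly_H q *: m).
have [P0|Q0] := indecomposable_split indM sP sQ dis tot.
  by case/eqP: m00; apply: P0; apply: wtS wm0 => _ ->.
by move=> m; have [u [v [Pu /Q0 -> ->]]] := tot m; rewrite addr0.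
Qed.

Section Fiber.
Variable a : K.
Hypothesis cosetM : forall m, weights_in (coset a) m.
Local Notation V := (weights_in [set a] : set M).
Local Notation W := (weights_in (~` [set a]) : set M).
Local Notation t := (act (H - a%:A) : {linear MK -> MK}).

Lemma weight_shift b m : weights_in [set b] m -> exists i j, V (shift i j *: m).
Proof.
move=> bm; case: (pselect (coset a b)) => [[i [j bE]]|nb].
  exists i, j; apply: wtS (wt_homog (homog_shift i j) bm) => c /= cb.
  by rewrite -[c](subrK (j%:R - i%:R)) cb bE addrA addrNK addrK.
have m0 : m = 0.
  apply: (@wt_disjoint _ M [set b] (coset a)) => //.
  by apply/seteqP; split=> // c [-> /nb].
by exists 0%N, 0%N; rewrite m0 scaler0; apply: (submodule0 (wt_subspace _ _)).
Qed.

(** Every weight vector is brought into [V] by an invertible shift, so a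
submodule is determined by its intersection with [V]. *)
Lemma sub_of_fiber N1 N2 : is_submodule N1 -> is_submodule N2 ->
  N1 `&` V `<=` N2 -> N1 `<=` N2.
Proof.
move=> sN1 sN2 N12; apply: sub_of_weights => // b m N1m bm.
have [i [j Vm]] := weight_shift bm.
rewrite -(shiftK i j m); apply: submoduleZ => //; apply: N12.
by split=> //; apply: submoduleZ.
Qed.

Lemma fiber_subspace : subspace V. Proof. exact: wt_subspace. Qed.

Lemma stable_sub_wt P : stable t (weights_in P).
Proof.
by move=> m /(wt_poly ('X - a%:P)); rewrite poly_HXsubC.
Qed.

Lemma fiber_complement : V `&` W `<=` [set 0].
Proof. by apply: wt_disjoint; rewrite setICr. Qed.

(** The submodule generated by a t-stable subspace [C] of [V], defined by the
requirement that the weight-[a] component of every shift lies in [C]; to be in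
[C + W] expresses this without a projection onto [V]. *)
Definition induced C : set M :=
  [set m | forall i j, @sum_set K MK C W (shift i j *: m)].

Lemma submodule_induced C : subspace C -> stable t C ->
  is_submodule (induced C).
Proof.
move=> sC tC; pose S := @sum_set K MK C W.
have sS : subspace S by apply: submodule_sum => //; apply: wt_subspace.
have SH m : S m -> S (H *: m).
  move=> Sm; have -> : H *: m = a%:A *: m + (H - a%:A) *: m.
    by rewrite -scalerDl addrC subrK.
  apply: (submoduleZD a sS) => //; have [u [v [Cu Wv ->]]] := Sm.
  exists (t u), (t v); split; [exact: tC | exact: stable_sub_wt |].
  exact: (linearD t).
apply: submodule_gen => // [|m Cm i j|m Cm i j|m Cm i j].
- apply/submoduleP; split=> [i j|c u v Cu Cv i j].
    by rewrite scaler0; apply: (submodule0 sS).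
  by rewrite shift_linear; apply: (submoduleZD c sS); [apply: Cu | apply: Cv].
- by rewrite shift_d; apply: Cm.
- by rewrite shift_J; apply: Cm.
- rewrite (homog_scale _ (homog_shift i j)).
  apply: (submoduleB sS); first by apply/SH/Cm.
  by apply: (submoduleZ (j%:R - i%:R) sS); apply: Cm.
Qed.

(** A shift with [i != j] moves the weight by a nonzero integer, hence out of
[V] into [W]; here the characteristic matters. *)
Lemma sub_induced C : subspace C -> C `<=` V -> C `<=` induced C.
Proof.
move=> sC CV c Cc i j; have [<-|ij] := eqVneq i j.
  by rewrite shiftii; apply: sum_setl => //; apply: wt_subspace.
apply: sum_setr => //; apply: wtS (wt_homog (homog_shift i j) (CV c Cc)) => b
  /= bE.
move=> ba; move: bE; rewrite ba => /eqP;
  rewrite subr_eq addrC -subr_eq subrr eq_sym.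
by rewrite subr_eq0 => /eqP /(natr_inj charK0) ji; rewrite ji eqxx in ij.
Qed.

Lemma induced_disjoint B C : B `<=` V -> C `<=` V -> subspace B -> stable t B ->
  subspace C -> stable t C ->
  B `&` C `<=` [set 0] -> induced B `&` induced C `<=` [set 0].
Proof.
move=> BV CV sB tB sC tC BC.
apply: sub_of_fiber; first by apply: submoduleI; apply: submodule_induced.
  exact: submodule_zero.
move=> m [[Bm Cm] Vm].
have inV E : E `<=` V -> subspace E -> induced E m -> E m.
  move=> EV sE /(_ 0%N 0%N); rewrite shiftii => -[u [w [Eu Ww mE]]].
  have -> : m = u; last by [].
  have w0 : w = 0.
    apply: fiber_complement; split=> //.
    have -> : w = (m : MK) - u by rewrite mE addrC addKr.
    by apply: (submoduleB fiber_subspace) => //; apply: EV.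
  by rewrite mE w0 addr0.
by apply: BC; split; apply: inV.
Qed.

(** A decomposition of [V] under [t] induces one of [M]; so [V] coincides with
its summand of rank one, and its stable subspaces form a chain. Submodules
inherit this from their intersections with [V]. *)
Lemma fiber_uniserial : indecomposable M -> (exists2 m, V m & m != 0) ->
  uniserial M.
Proof.
move=> indM V0.
have nV : nilpotent_on t V := @wt_act_nilpotent _ M a.
have sV := fiber_subspace; have tV := @stable_sub_wt [set a].
have [s [B [C [[sB tB sC tC] [BV CV BC VBC [s0 Bs kerB]]]]]] :=
  exists_rank1_summand sV tV nV V0.
have sIB := submodule_induced sB tB; have sIC := submodule_induced sC tC.
have tot m : sum_set (induced B) (induced C) m.
  apply: (@sub_of_fiber [set: M] (sum_set (induced B) (induced C))) => //.
  - exact: submodule_full.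
  - exact: submodule_sum.
  move=> v [_ /VBC[b [c [Bb Cc ->]]]].
  by exists b, c; split=> //; apply: sub_induced.
have [IB0|IC0] := indecomposable_split indM sIB sIC
  (induced_disjoint BV CV sB tB sC tC BC) tot.
  by case/eqP: s0; apply: IB0; apply: sub_induced.
have kerV v : V v -> t v = 0 -> exists k : K, v = k *: (s : MK).
  move=> /VBC[b [c [Bb Cc vE]]] tv; apply: kerB => //.
  by have c0 : c = 0 by [apply: IC0; apply: sub_induced]; rewrite vE c0 addr0.
move=> N1 N2 sN1 sN2.
have sNV N : is_submodule N -> subspace (N `&` V).
  by move=> sN; apply: submoduleI => //; apply: submodule_subspace.
have tNV N : is_submodule N -> stable t (N `&` V).
  by move=> sN m [Nm Vm]; split; [apply: submoduleZ | apply: tV].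
have [N12|N21] := rank1_uniserial nV kerV tV sV (sNV _ sN1) (tNV _ sN1)
  (@subIsetr _ _ _) (sNV _ sN2) (tNV _ sN2) (@subIsetr _ _ _).
  by left; apply: sub_of_fiber => // m /N12[].
by right; apply: sub_of_fiber => // m /N21[].
Qed.

End Fiber.

Lemma bijective_uniserial : indecomposable M -> uniserial M.
Proof.
move=> indM; have [a [m am m0]] : exists a, exists2 m : M, weights_in [set a]
  m & m != 0.
  apply: contrapT => nowt; case: indM => -[m /eqP m0] _; apply: m0.
  apply: (sub_of_weights wtM (@submodule_full _ M) (@submodule_zero _ M)) => //.
  move=> a v _ av; apply: contrapT => /eqP v0; apply: nowt.
  by exists a; exists v.
have nz : exists2 m : M, weights_in [set a] m & m != 0 by exists m.
exact: (fiber_uniserial (indecomposable_coset indM nz) indM nz).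
Qed.

End Bijective.

(** * Uniseriality *)

Theorem corollary2p6 (K : fieldType) (charK0 : [pchar K]%R =i pred0)
    (M : lmodType (I1 K)) :
  indecomposable M -> generalized_weight M -> uniserial M.
Proof.
move=> indM /generalized_weight_wt wtM.
have [torM|bijM] := dtorsion_or_bijective charK0 indM wtM.
  exact: dtorsion_uniserial.
exact: bijective_uniserial.
Qed.
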